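(* Let $(\mathfrak g,[\cdot,\cdot]_{\mathfrak g},r)$ be a triangular Lie bialgebra over $\mathbf K$, with $\mathfrak g$ finite-dimensional. Then there is a one-to-one correspondence between the space of equivalence classes of infinitesimal deformations of $(\mathfrak g,[\cdot,\cdot]_{\mathfrak g},r)$ and the second cohomology group $\mathcal H^2_{\mathrm{TLB}}(\mathfrak g,r)$.
   Context: $\mathbf K$ is a field of characteristic $0$; all vector spaces are finite-dimensional. The pairing between $\wedge^k\mathfrak g$ and $\wedge^k\mathfrak g^*$ is $\langle x_1\wedge\cdots\wedge x_k,\xi_1\wedge\cdots\wedge\xi_k\rangle=\det(\langle x_i,\xi_j\rangle)$, and $\wedge^2\mathfrak g\subset\mathfrak g\otimes\mathfrak g$ via $x\wedge y=x\otimes y-y\otimes x$. Triangular Lie bialgebra: for a Lie algebra $\mathfrak g$ the Schouten-Nijenhuis bracket is $[x_1\wedge\cdots\wedge x_p,y_1\wedge\cdots\wedge y_q]_{SN}=\sum_{i,j}(-1)^{i+j}[x_i,y_j]_{\mathfrak g}\wedge x_1\wedge\cdots\hat x_i\cdots\wedge x_p\wedge y_1\wedge\cdots\hat y_j\cdots\wedge y_q$. A skew-symmetric $r$-matrix is $r\in\wedge^2\mathfrak g$ with $[r,r]_{SN}=0$; then $\mathfrak g$ with cobracket $\delta_r(x)=[x,r]_{SN}$ is a Lie bialgebra, called triangular and denoted $(\mathfrak g,[\cdot,\cdot]_{\mathfrak g},r)$. A homomorphism $\phi:(\mathfrak g_2,r_2)\to(\mathfrak g_1,r_1)$ of triangular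 Lie bialgebras is a Lie algebra homomorphism with $(\phi\otimes\phi)(r_2)=r_1$; an isomorphism is an invertible one. The same definitions apply over a commutative ring $\mathsf R$. Deformations: let $\mathsf R=\mathbf K[t]/(t^2)$ with augmentation $\epsilon:\mathsf R\to\mathbf K$. An infinitesimal deformation of $(\mathfrak g,[\cdot,\cdot]_{\mathfrak g},r)$ consists of an $\mathsf R$-Lie algebra structure $[\cdot,\cdot]_{\mathsf R}$ on $\mathsf R\otimes_{\mathbf K}\mathfrak g$ and a skew-symmetric $r$-matrix $\mathcal X\in(\mathsf R\otimes\mathfrak g)\otimes_{\mathsf R}(\mathsf R\otimes\mathfrak g)\cong\mathsf R\otimes\mathfrak g\otimes\mathfrak g$ such that $\epsilon\otimes\mathrm{Id}_{\mathfrak g}$ is an $\mathsf R$-Lie algebra homomorphism to $(\mathfrak g,[\cdot,\cdot]_{\mathfrak g})$ ($\mathfrak g$ being an $\mathsf R$-module via $\epsilon$) and $(\epsilon\otimes\mathrm{Id}_{\mathfrak g}\otimes\mathrm{Id}_{\mathfrak g})(\mathcal X)=r$. Two infinitesimal deformations $(\mathsf R\otimes\mathfrak g,[\cdot,\cdot]_{\mathsf R},\mathcal X)$, $(\mathsf R\otimes\mathfrak g,[\cdot,\cdot]'_{\mathsf R},\mathcal X')$ are equivalent if there is a triangular $\mathsf R$-Lie bialgebra isomorphism $\phi$ from the second to the first with $(\epsilon\otimes\mathrm{Id}_{\mathfrak g})\circ\phi=\epsilon\otimes\mathrm{Id}_{\mathfrak g}$. Cohomology: $\mathfrak C^0_{\mathrm{TLB}}(\mathfrak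 g,r)=0$, $\mathfrak C^1_{\mathrm{TLB}}(\mathfrak g,r)=\mathrm{Hom}(\mathfrak g,\mathfrak g)$, $\mathfrak C^n_{\mathrm{TLB}}(\mathfrak g,r)=\mathrm{Hom}(\wedge^n\mathfrak g,\mathfrak g)\oplus\wedge^n\mathfrak g$ for $n\ge2$, with coboundary $\mathcal D_{\mathrm{TLB}}(f,\chi)=(\mathrm d_{CE}f,\Theta f+\mathrm d_r\chi)$ ($\chi=0$ if $n=1$). Here $\mathrm d_{CE}$ is the Chevalley-Eilenberg coboundary with adjoint coefficients, $(\mathrm d_{CE}f)(x_1,\dots,x_{n+1})=\sum_i(-1)^{i+1}[x_i,f(\dots,\hat x_i,\dots)]_{\mathfrak g}+\sum_{i<j}(-1)^{i+j}f([x_i,x_j]_{\mathfrak g},\dots,\hat x_i,\dots,\hat x_j,\dots)$; $\mathrm d_r\chi=[r,\chi]_{SN}$; $r^\sharp:\mathfrak g^*\to\mathfrak g$ is given by $\langle r^\sharp(\xi),\eta\rangle=\langle r,\xi\wedge\eta\rangle$; and $\Theta:\mathrm{Hom}(\wedge^n\mathfrak g,\mathfrak g)\to\wedge^{n+1}\mathfrak g$ is given by $\langle\Theta f,\xi_1\wedge\cdots\wedge\xi_{n+1}\rangle=\sum_{i=1}^{n+1}(-1)^{i+1}\langle\xi_i,f(r^\sharp(\xi_1),\dots,\widehat{r^\sharp(\xi_i)},\dots,r^\sharp(\xi_{n+1}))\rangle$. $\mathcal H^n_{\mathrm{TLB}}(\mathfrak g,r)$ denotes the $n$-th cohomology. 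*)

(* Defs.v *)
From HB Require Import structures.
From mathcomp Require Import all_boot all_order all_algebra.
From mathcomp Require Import boolp classical_sets functions.

Set Implicit Arguments.
Unset Strict Implicit.
Unset Printing Implicit Defensive.

Import GRing.Theory VectorInternalTheory.
Local Open Scope classical_set_scope.
Local Open Scope ring_scope.

(* For [R : comNzRingType], a [vectType R] is a free R-module of finite rank. *)
Notation dual R V := 'Hom(V, R^o).

Section Multilinear.
Variables (R : comNzRingType) (n : nat) (U W : lmodType R).
Implicit Types f : ('I_n -> U) -> W.

Definition multilinear f := forall (x : 'I_n -> U) i a u v,
  f [eta x with i |-> a *: u + v] =
    a *: f [eta x with i |-> u] + f [eta x with i |-> v].

Definition alternating f := forall (x : 'I_n -> U) i j,
  i != j -> x i = x j -> f x = 0.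

Definition altmap : set (('I_n -> U) -> W) :=
  [set f | multilinear f /\ alternating f].

End Multilinear.

Arguments altmap {R} n U W.

(* Hom(/\^n V, V) is [altmap n V V].  As V is free of finite rank, the pairing
   between /\^n V and /\^n V^* identifies /\^n V with the alternating n-linear
   forms on V^*: this set is [extpow V n], inside the type [multivec V n]. *)
Notation multimap V n := (('I_n -> V) -> V).
Notation multivec R V n := (('I_n -> dual R V) -> R^o).

Section ExteriorPowers.
Variables (R : comNzRingType) (V : vectType R).

Definition extpow n : set (multivec R V n) := altmap n (dual R V) R^o.

Definition wedge n (x : 'I_n -> V) : multivec R V n :=
  fun xi => \det (\matrix_(i, j) xi j (x i)).

Definition stdvec (i : 'I_(dim V)) : V := r2v (delta_mx 0 i).
Definition stdform (i : 'I_(dim V)) : dual R V :=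
  linfun (fun x => v2r x 0 i : R^o).

Definition fam (T : zmodType) n (s : seq T) : 'I_n -> T := fun k => s`_k.
Definition omit (T : Type) n (i : 'I_n) (x : 'I_n -> T) : seq T :=
  [seq x k | k <- enum 'I_n & k != i].
Definition omit2 (T : Type) n (i j : 'I_n) (x : 'I_n -> T) : seq T :=
  [seq x k | k <- enum 'I_n & (k != i) && (k != j)].

(* Signs: indices start at 0, which does not change the parity of i + j. *)
Definition sn_dec (br : V -> V -> V) p q (x : 'I_p.+1 -> V) (y : 'I_q.+1 -> V) :
    multivec R V (p + q).+1 :=
  \sum_(i < p.+1) \sum_(j < q.+1)
    (-1) ^+ (i + j) *: wedge (fam (br (x i) (y j) :: omit i x ++ omit j y)).

(* P in /\^p V is the sum over i_1 < ... < i_p of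
   P(e^{i_1}, ..., e^{i_p}) e_{i_1} /\ ... /\ e_{i_p}; [sn] is the bilinear
   extension of [sn_dec] along this expansion. *)
Definition increasing p (I : {ffun 'I_p -> 'I_(dim V)}) : bool :=
  [forall a : 'I_p, forall b : 'I_p, (a < b)%N ==> (I a < I b)%N].

Definition sn (br : V -> V -> V) p q (P : multivec R V p.+1)
    (Q : multivec R V q.+1) : multivec R V (p + q).+1 :=
  \sum_(I : {ffun 'I_p.+1 -> 'I_(dim V)} | increasing I)
    \sum_(J : {ffun 'I_q.+1 -> 'I_(dim V)} | increasing J)
      ((P (stdform \o I) : R) * (Q (stdform \o J) : R)) *:
        sn_dec br (stdvec \o I) (stdvec \o J).

Definition sharp (r : multivec R V 2) (xi : dual R V) : V :=
  r2v (\row_i r (fam [:: xi; stdform i])).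

Lemma stdformE i x : stdform i x = v2r x 0 i.
Proof.
have lin : linear ((fun y => v2r y 0 i) : V -> R^o).
  by move=> a u v; rewrite linearP !mxE.
pose m := GRing.isLinear.Build _ _ _ _ _ lin.
pose f : {linear V -> R^o} := HB.pack (_ : V -> R^o) m.
exact: (lfunE f).
Qed.

Lemma form_expansion (eta : dual R V) : eta = \sum_i eta (stdvec i) *: stdform i.
Proof.
apply/lfunP=> x; rewrite sum_lfunE -[x in LHS]v2rK [v2r x]row_sum_delta.
rewrite !linear_sum; apply: eq_bigr => i _ /=.
by rewrite !linearZ scale_lfunE stdformE; exact: mulrC.
Qed.

Lemma sharpP (r : multivec R V 2) (xi eta : dual R V) :
  @extpow 2 r -> eta (sharp r xi) = r (fam [:: xi; eta]).
Proof.
move=> [rlin _].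
have upd e : fam [:: xi; e] = [eta fam [:: xi; 0] with (ord_max : 'I_2) |-> e].
  by apply/funext=> -[[|[|k]] hk].
have lin : linear (fun e => r (fam [:: xi; e])).
  by move=> a u v; rewrite [fam [:: xi; _]]upd rlin -!upd.
pose m := GRing.isLinear.Build _ _ _ _ _ lin.
pose f : {linear dual R V -> R^o} := HB.pack (_ : dual R V -> R^o) m.
rewrite -[RHS]/(f eta) {1 2}[eta]form_expansion sum_lfunE linear_sum.
apply: eq_bigr => i _; rewrite scale_lfunE linearZ stdformE /sharp r2vK mxE.
by [].
Qed.

End ExteriorPowers.

Arguments extpow {R} V n.

Record is_lie_bracket (R : comNzRingType) (V : lmodType R) (br : V -> V -> V) :
    Prop := IsLieBracket {
  lie_linearl : forall y, linear (br^~ y);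
  lie_linearr : forall x, linear (br x);
  lie_alt : forall x, br x x = 0;
  lie_jacobi : forall x y z,
    br x (br y z) + br y (br z x) + br z (br x y) = 0
}.

(* A triangular Lie bialgebra is determined by its bracket and its r-matrix,
   the cobracket being x |-> [x, r]_SN. *)
Record tlb (R : comNzRingType) (V : vectType R) := TLB {
  lie : V -> V -> V;
  rmx : multivec R V 2;
  lieP : is_lie_bracket lie;
  rmx_skew : extpow V 2 rmx;
  rmxP : sn lie (rmx : multivec R V 1.+1) (rmx : multivec R V 1.+1) = 0
}.

Section Morphisms.
Variables (R : comNzRingType) (V W : vectType R).

(* phi (x) phi : /\^2 V -> /\^2 W *)
Definition tens2 (phi : 'Hom(V, W)) (r : multivec R V 2) : multivec R W 2 :=
  fun xi => r (fun i => (xi i \o phi)%VF).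

Definition tlb_hom (A : tlb V) (B : tlb W) (phi : 'Hom(V, W)) :=
  (forall x y, phi (lie A x y) = lie B (phi x) (phi y)) /\
  tens2 phi (rmx A) = rmx B.

Definition tlb_iso (A : tlb V) (B : tlb W) (phi : 'Hom(V, W)) :=
  tlb_hom A B phi /\ bijective phi.

End Morphisms.

Section Cohomology.
Variables (R : comNzRingType) (V : vectType R) (A : tlb V).
Local Notation "[ x , y ]" := (lie A x y).
Local Notation r := (rmx A).

(* Indices start at 0. *)
Definition d_CE n (f : multimap V n) : multimap V n.+1 := fun x =>
  \sum_(i < n.+1) (-1) ^+ i *: [x i, f (fam (omit i x))] +
  \sum_(i < n.+1) \sum_(j < n.+1 | (i < j)%N)
    (-1) ^+ (i + j) *: f (fam ([x i, x j] :: omit2 i j x)).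

Definition Theta n (f : multimap V n) : multivec R V n.+1 := fun xi =>
  \sum_(i < n.+1) (-1) ^+ i *: xi i (f (sharp r \o fam (omit i xi))).

Definition d_r n (chi : multivec R V n.+1) : multivec R V n.+2 :=
  sn (lie A) (r : multivec R V 1.+1) chi.

Notation cochain_type n := (multimap V n * multivec R V n)%type.

Definition tlb_cochain n : set (cochain_type n) :=
  [set c | [/\ altmap n V V c.1, extpow V n c.2,
               n = 0%N -> c.1 = 0 & (n <= 1)%N -> c.2 = 0]].

(* The coboundary is 0 on C^0 = 0. *)
Definition tlb_D n : cochain_type n -> cochain_type n.+1 :=
  if n is m.+1 then fun c => (d_CE c.1, Theta c.1 + d_r c.2) else fun=> 0.

Definition tlb_cocycle n : set (cochain_type n) :=
  [set c | tlb_cochain c /\ tlb_D c = 0].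

Definition tlb_coboundary n : set (cochain_type n) :=
  if n is m.+1 then [set tlb_D c | c in @tlb_cochain m] else [set 0].

Definition tlb_cohomology n : set (set (cochain_type n)) :=
  [set [set z + b | b in @tlb_coboundary n] | z in @tlb_cocycle n].

End Cohomology.

Arguments tlb_cochain {R V} n.
Arguments tlb_cocycle {R V} A n.
Arguments tlb_coboundary {R V} A n.
Arguments tlb_cohomology {R V} A n.

(* R = K[t]/(t^2), with 'qX the class of t. *)
Notation dualnum K := {poly %/ ('X^2 : {poly K})}.

Section DualNumbers.
Variable K : fieldType.
Implicit Types a b : dualnum K.

Definition augmentation a : K := (a : {poly K})`_0.
Definition dual_number (x y : K) : dualnum K := x%:A + y *: 'qX.

Lemma mk_monicX2 : mk_monic ('X^2 : {poly K}) = 'X^2.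
Proof. by rewrite /mk_monic size_polyXn monicXn. Qed.

Lemma dualnumM a b :
  (a * b)%R = take_poly 2 ((a : {poly K}) * (b : {poly K})) :> {poly K}.
Proof.
rewrite poly_of_qpolyM Pdiv.RingMonic.take_poly_rmodp.
by congr Pdiv.CommonRing.rmodp; exact: mk_monicX2.
Qed.

Lemma coef0_dualnumM a b :
  ((a * b)%R : {poly K})`_0 = (a : {poly K})`_0 * (b : {poly K})`_0.
Proof.
by rewrite dualnumM coef_take_poly coefM big_ord_recl big_ord0 addr0.
Qed.

Fact augmentation_zmod_morphism : zmod_morphism augmentation.
Proof. by move=> a b; rewrite /augmentation raddfB coefB. Qed.
Fact augmentation_monoid_morphism : monoid_morphism augmentation.
Proof. by split; [exact: coef1 | exact: coef0_dualnumM]. Qed.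
HB.instance Definition _ := GRing.isZmodMorphism.Build (dualnum K) K augmentation
  augmentation_zmod_morphism.
HB.instance Definition _ := GRing.isMonoidMorphism.Build (dualnum K) K
  augmentation augmentation_monoid_morphism.

Lemma coef1_dualnumM a b :
  ((a * b)%R : {poly K})`_1 = (a : {poly K})`_0 * (b : {poly K})`_1 +
                              (a : {poly K})`_1 * (b : {poly K})`_0.
Proof.
by rewrite dualnumM coef_take_poly coefM !big_ord_recl big_ord0 addr0.
Qed.

Lemma dualnum_inj a b : (a : {poly K})`_0 = (b : {poly K})`_0 ->
  (a : {poly K})`_1 = (b : {poly K})`_1 -> a = b.
Proof.
move=> e0 e1; apply/val_inj/polyP=> -[|[|i]] //=.
have s (c : dualnum K) : (size (c : {poly K}) <= i.+2)%N.
  by apply: leq_trans (size_npoly c) _; rewrite mk_monicX2 size_polyXn.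
by rewrite !nth_default.
Qed.

Lemma coef0_dual_number x y : (dual_number x y : {poly K})`_0 = x.
Proof.
rewrite /dual_number poly_of_qpolyD !poly_of_qpolyZ coefD !coefZ.
rewrite qpolyXE ?size_polyXn ?monicXn // coefX.
have -> : ((1 : dualnum K) : {poly K}) = 1 by [].
by rewrite coef1 /= ?mulr0 ?mulr1 ?addr0 ?add0r.
Qed.

Lemma coef1_dual_number x y : (dual_number x y : {poly K})`_1 = y.
Proof.
rewrite /dual_number poly_of_qpolyD !poly_of_qpolyZ coefD !coefZ.
rewrite qpolyXE ?size_polyXn ?monicXn // coefX.
have -> : ((1 : dualnum K) : {poly K}) = 1 by [].
by rewrite coef1 /= ?mulr0 ?mulr1 ?addr0 ?add0r.
Qed.

Lemma dual_number_linear a x y x' y' :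
  dual_number ((a : {poly K})`_0 * x + x')
    ((a : {poly K})`_0 * y + (a : {poly K})`_1 * x + y') =
  a * dual_number x y + dual_number x' y'.
Proof.
apply: dualnum_inj; rewrite [in RHS]poly_of_qpolyD [RHS]coefD.
  by rewrite coef0_dualnumM !coef0_dual_number.
by rewrite coef1_dualnumM !coef1_dual_number coef0_dual_number.
Qed.

End DualNumbers.

(* R (x) g = g (+) t g; the pair (x, y) stands for 1 (x) x + t (x) y. *)
Definition Rext (K : fieldType) (g : vectType K) : Type := (g * g)%type.

Section ExtensionOfScalars.
Variables (K : fieldType) (g : vectType K).
Implicit Types (a b : dualnum K) (z : Rext g).

HB.instance Definition _ := GRing.Zmodule.copy (Rext g) (g * g)%type.

Definition Rext_scale a z : Rext g :=
  ((a : {poly K})`_0 *: z.1,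
   (a : {poly K})`_0 *: z.2 + (a : {poly K})`_1 *: z.1).

Fact Rext_scaleA a b z :
  Rext_scale a (Rext_scale b z) = Rext_scale (a * b) z.
Proof.
rewrite /Rext_scale coef0_dualnumM coef1_dualnumM /= !scalerDr !scalerDl.
by rewrite !scalerA addrA.
Qed.

Fact Rext_scale1 : left_id 1 Rext_scale.
Proof.
move=> [x y]; rewrite /Rext_scale /= !coef1 /=.
by rewrite !scale1r scale0r addr0.
Qed.

Fact Rext_scaleDr : right_distributive Rext_scale +%R.
Proof.
move=> a [x y] [x' y']; congr pair; rewrite /= !scalerDr //.
by rewrite addrACA.
Qed.

Fact Rext_scaleDl z : {morph Rext_scale^~ z : a b / a + b}.
Proof.
move=> a b; rewrite /Rext_scale !poly_of_qpolyD !coefD.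
by congr pair; rewrite /= !scalerDl // addrACA.
Qed.

HB.instance Definition _ := GRing.Zmodule_isLmodule.Build (dualnum K) (Rext g)
  Rext_scaleA Rext_scale1 Rext_scaleDr Rext_scaleDl.

Fact Rext_vector : Vector.axiom (dim g) (Rext g).
Proof.
exists (fun z => \row_i dual_number (v2r z.1 0 i) (v2r z.2 0 i)).
  move=> a u v; apply/rowP=> i; rewrite !mxE /= -dual_number_linear.
  by rewrite !linearD !linearZ !mxE.
pose inv (w : 'rV[dualnum K]_(dim g)) : Rext g :=
  (r2v (map_mx (fun a : dualnum K => (a : {poly K})`_0) w),
   r2v (map_mx (fun a : dualnum K => (a : {poly K})`_1) w)).
exists inv.
  move=> [x y]; congr pair; apply: (canLR v2rK); apply/rowP=> i; rewrite !mxE.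
    exact: coef0_dual_number.
  exact: coef1_dual_number.
move=> w; apply/rowP=> i; rewrite mxE /inv /= !r2vK !mxE; apply: dualnum_inj.
  by rewrite coef0_dual_number.
by rewrite coef1_dual_number.
Qed.

HB.instance Definition _ :=
  Lmodule_hasFinDim.Build (dualnum K) (Rext g) Rext_vector.

(* epsilon (x) Id *)
Definition red z : g := z.1.

Lemma redZ a z : red (a *: z) = augmentation a *: red z.
Proof. by []. Qed.

(* The R-linear extension of a linear form on g. *)
Definition extform (xi : dual K g) : dual (dualnum K) (Rext g) :=
  linfun (fun z => dual_number (xi z.1) (xi z.2) : (dualnum K)^o).

Lemma extformE xi z : extform xi z = dual_number (xi z.1) (xi z.2).
Proof.
have lin : linear ((fun z => dual_number (xi z.1) (xi z.2)) :
                     Rext g -> (dualnum K)^o).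
  move=> a u v; apply: etrans (dual_number_linear a _ _ _ _).
  by congr dual_number; rewrite /= !linearD !linearZ.
pose m := GRing.isLinear.Build _ _ _ _ _ lin.
pose f : {linear Rext g -> (dualnum K)^o} := HB.pack (_ : _ -> _^o) m.
exact: (lfunE f).
Qed.

(* epsilon (x) Id (x) Id, in terms of bilinear forms on the duals *)
Definition red2 (X : multivec (dualnum K) (Rext g) 2) : multivec K g 2 :=
  fun xi => augmentation (X (extform \o xi)).

Lemma red2_wedge (x : 'I_2 -> Rext g) : red2 (wedge x) = wedge (red \o x).
Proof.
apply/funext=> xi; rewrite /red2 /wedge -det_map_mx; congr (\det _).
by apply/matrixP=> i j; rewrite !mxE /= extformE; exact: coef0_dual_number.
Qed.

End ExtensionOfScalars.

Section Deformations.
Variables (K : fieldType) (g : vectType K) (A : tlb g).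

Definition deformation : set (tlb (Rext g)) :=
  [set D | (forall x y, red (lie D x y) = lie A (red x) (red y)) /\
           red2 (rmx D) = rmx A].

Definition equivalent (D D' : tlb (Rext g)) :=
  exists phi : 'Hom(Rext g, Rext g),
    tlb_iso D' D phi /\ forall x, red (phi x) = red x.

Definition deformation_classes : set (set (tlb (Rext g))) :=
  [set [set D' | deformation D' /\ equivalent D D'] | D in deformation].

End Deformations.

(* Main.v *)
From HB Require Import structures.
Require Import Defs.
From mathcomp Require Import all_boot all_order all_algebra.
From mathcomp Require Import boolp classical_sets functions.
From mathcomp Require Import ring.

Set Implicit Arguments.
Unset Strict Implicit.
Unset Printing Implicit Defensive.

Import GRing.Theory VectorInternalTheory.
Local Open Scope classical_set_scope.
Local Open Scope ring_scope.

(** A deformation over K[t]/(t^2) is determined by its t-coefficients.  As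
    [R (x) g] is [g (+) t g], the deformed bracket is
      [(x + t u, y + t v) |-> [x, y] + t (w (x, y) + [u, y] + [x, v])]
    for an alternating map [w], and the deformed r-matrix is [r + t chi] with
    [chi] a bivector.  The bijection sends a class of deformations to the set
    of pairs [(w, chi)] of its members ([eps_part]), which turns out to be a
    cohomology class.  Three facts are needed.

    First, the equations for a deformation are those for a 2-cocycle.  The
    t-coefficient of the Jacobi identity is [d_CE w = 0] ([ext_lie_bracketP]).
    For the r-matrix, the Schouten bracket of two bivectors is computed by
      [P, Q](xi0, xi1, xi2) = sum over permutations s of
         sign(s) xi_s0 ([P# xi_s1, Q# xi_s2])
    ([sn_bivectorsE]), valid for any alternating bilinear operation in place
    of the Lie bracket.  Since the sharp map of [r + t chi] is [r# + t chi#],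
    the t-coefficient of the Schouten square of [r + t chi] splits into a part
    in [w], equal to [2 Theta w], and a part in [chi], equal to [2 d_r chi]
    ([sn_extform]).  Characteristic different from 2 then gives
    [Theta w + d_r chi = 0] ([eps_part_cocycle]); conversely every cocycle is
    the t-part of a deformation ([cocycle_eps_part]), because a trilinear
    expression over the dual numbers vanishes once it does on forms extended
    from [g].

    Second, an equivalence reduces to the identity modulo t, so it is a shear
    [x + t u |-> x + t (u + N x)] with [N] an endomorphism of [g]
    ([red_shear]).  Expanding the two conditions of a homomorphism, the
    t-parts of the two deformations differ by the coboundary of [N]
    ([shear_homP]).

    Third, shears are invertible, so a deformation can be pulled back along
    any of them ([shear_pullback]): the t-parts of an equivalence class fill
    out a whole coset of the coboundaries. *)

(** * Alternating bilinear maps *)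

(** Common ground of Lie brackets, alternating cochains of degree 2 and
    bivectors, written without families indexed by ['I_2]. *)
Record alt_bilinear (R : comNzRingType) (U W : lmodType R) (B : U -> U -> W) :
    Prop := AltBilinear {
  abil_linearl : forall v, linear (B^~ v);
  abil_linearr : forall u, linear (B u);
  abil_alt : forall u, B u u = 0
}.

Section AltBilinear.
Variables (R : comNzRingType) (U W : lmodType R) (B : U -> U -> W).
Hypothesis BP : alt_bilinear B.

Lemma abil0l v : B 0 v = 0.
Proof.
have := abil_linearl BP v (-1) 0 0.
by rewrite scaler0 addr0 scaleN1r addNr.
Qed.

Lemma abilDl u u' v : B (u + u') v = B u v + B u' v.
Proof. by have := abil_linearl BP v 1 u u'; rewrite !scale1r. Qed.

Lemma abilZl a u v : B (a *: u) v = a *: B u v.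
Proof. by have := abil_linearl BP v a u 0; rewrite abil0l !addr0. Qed.

Lemma abil_skew u v : B u v = - B v u.
Proof.
have := abil_alt BP (u + v); rewrite abilDl.
have E w : B w (u + v) = B w u + B w v.
  by have := abil_linearr BP w 1 u v; rewrite !scale1r.
by rewrite !E !(abil_alt BP) addr0 add0r => /eqP; rewrite addr_eq0 => /eqP.
Qed.

Lemma abilDr u v v' : B u (v + v') = B u v + B u v'.
Proof. by have := abil_linearr BP u 1 v v'; rewrite !scale1r. Qed.

Lemma abilZr a u v : B u (a *: v) = a *: B u v.
Proof. by rewrite abil_skew abilZl -scalerN -abil_skew. Qed.

Lemma abil0r u : B u 0 = 0.
Proof. by rewrite abil_skew abil0l oppr0. Qed.

Lemma abilNl u v : B (- u) v = - B u v.
Proof. by rewrite -scaleN1r abilZl scaleN1r. Qed.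

Lemma abilNr u v : B u (- v) = - B u v.
Proof. by rewrite -scaleN1r abilZr scaleN1r. Qed.

Lemma abil_suml I (s : seq I) (F : I -> U) v :
  B (\sum_(i <- s) F i) v = \sum_(i <- s) B (F i) v.
Proof. exact: (big_morph (B^~ v) (fun x y => abilDl x y v) (abil0l v)). Qed.

Lemma abil_sumr I (s : seq I) (F : I -> U) u :
  B u (\sum_(i <- s) F i) = \sum_(i <- s) B u (F i).
Proof. exact: (big_morph (B u) (abilDr u) (abil0r u)). Qed.

End AltBilinear.

Lemma lie_abil (R : comNzRingType) (V : lmodType R) (br : V -> V -> V) :
  is_lie_bracket br -> alt_bilinear br.
Proof. by case. Qed.

(** Lets a linear map be built from any function proved linear, without first
    declaring a canonical structure on it. *)
Lemma linfun_linearE (R : comNzRingType) (U V : vectType R) (f : U -> V) :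
  linear f -> forall x, linfun f x = f x.
Proof.
move=> lin x; pose m := GRing.isLinear.Build _ _ _ _ _ lin.
pose f' : {linear U -> V} := HB.pack f m.
exact: (lfunE f').
Qed.

Section Families.
Variable U : zmodType.

Lemma fam1 (x : 'I_1 -> U) : x = fam [:: x ord0].
Proof.
apply/funext=> -[[|k] hk] //.
by congr x; apply: val_inj.
Qed.

Lemma fam2 (x : 'I_2 -> U) : x = fam [:: x ord0; x ord_max].
Proof. by apply/funext=> -[[|[|k]] hk] //; congr x; apply: val_inj. Qed.

Lemma fam3 (x : 'I_3 -> U) : exists u v w, x = fam [:: u; v; w].
Proof.
exists (x ord0), (x (inord 1)), (x ord_max).
by apply/funext=> -[[|[|[|k]]] hk] //; congr x; apply: val_inj => //=;
  rewrite inordK.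
Qed.

End Families.

Section Altmap.
Variables (R : comNzRingType) (U W : lmodType R).

Lemma altmap1P (f : ('I_1 -> U) -> W) :
  altmap 1 U W f <-> linear (fun u => f (fam [:: u])).
Proof.
have upd (x : 'I_1 -> U) i u : fam [:: u] = [eta x with i |-> u].
  rewrite (ord1 i); apply/funext=> k; rewrite (ord1 k) /=.
  by [].
split=> [[fl _] a u v|fl].
  by have := fl (fam [:: 0]) ord0 a u v; rewrite -!upd.
split=> [x i a u v|x i j]; first by rewrite -!upd fl.
by rewrite (ord1 i) (ord1 j) eqxx.
Qed.

Lemma altmap2P (f : ('I_2 -> U) -> W) :
  altmap 2 U W f <-> alt_bilinear (fun u v => f (fam [:: u; v])).
Proof.
have upd0 (u v w : U) :
    fam [:: w; v] = [eta fam [:: u; v] with (ord0 : 'I_2) |-> w].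
  by apply/funext=> -[[|[|k]] hk].
have upd1 (u v w : U) :
    fam [:: u; w] = [eta fam [:: u; v] with (ord_max : 'I_2) |-> w].
  by apply/funext=> -[[|[|k]] hk].
have ordE (i : 'I_2) : i = ord0 \/ i = ord_max.
  by case: i => -[|[|k]] hk //; [left|right]; apply: val_inj.
split=> [[fl fa]|[fl fr fa]]; split.
- move=> v a u u'.
  by have := fl (fam [:: 0; v]) ord0 a u u'; rewrite -!(upd0 0).
- move=> u a v v'.
  by have := fl (fam [:: u; 0]) ord_max a v v'; rewrite -!(upd1 _ 0).
- by move=> u; exact: (fa (fam [:: u; u]) ord0 ord_max).
- move=> x i a u v; rewrite (fam2 x).
  by case: (ordE i) => ->; rewrite -?upd0 -?upd1 ?fl ?fr.
- move=> x i j; rewrite (fam2 x).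
  by case: (ordE i) => ->; case: (ordE j) => -> // _;
     rewrite /fam /= => E; rewrite ?E -/(fam _) -?E; exact: fa.
Qed.

Lemma altmap2_of (B : U -> U -> W) :
  alt_bilinear B -> altmap 2 U W (fun x => B (x ord0) (x ord_max)).
Proof. by move=> BP; apply/altmap2P. Qed.

End Altmap.

(** * The Schouten bracket of two bivectors *)

Section Bivectors.

Lemma sum_increasing_pairs (M : zmodType) n (F : 'I_n -> 'I_n -> M) :
  \sum_(I : {ffun 'I_2 -> 'I_n} | [forall a : 'I_2, forall b : 'I_2,
     (a < b)%N ==> (I a < I b)%N]) F (I ord0) (I ord_max) =
  \sum_(a < n) \sum_(b < n | (a < b)%N) F a b.
Proof.
rewrite pair_big_dep /=.
pose h (q : 'I_n * 'I_n) := [ffun k : 'I_2 => if k == ord0 then q.1 else q.2].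
pose h' (I : {ffun 'I_2 -> 'I_n}) := (I ord0, I ord_max).
have hK : cancel h h' by move=> [a b]; rewrite /h' /h !ffunE.
have h'K : cancel h' h.
  move=> I; apply/ffunP=> k; rewrite ffunE /=.
  by case: k => -[|[|k]] hk //=; congr (I _); apply: val_inj.
rewrite (reindex h) /=; last by exists h' => q _; [apply: hK | apply: h'K].
apply: eq_big => [[a b]|[a b] _]; last by rewrite !ffunE.
apply/'forall_forallP/idP => /= [/(_ ord0 ord_max)|ab i j].
  by rewrite !ffunE.
by case: i j => -[|[|i]] hi // [[|[|j]] hj] //; rewrite !ffunE.
Qed.

(** Turns a sum over increasing pairs of indices into the sum over all pairs:
    a skew [p] absorbs the antisymmetrization of [h]. *)
Lemma sum_skew (R : comNzRingType) n (p h : 'I_n -> 'I_n -> R) :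
  (forall a, p a a = 0) -> (forall a b, p a b = - p b a) ->
  \sum_(a < n) \sum_(b < n | (a < b)%N) p a b * (h a b - h b a) =
  \sum_(a < n) \sum_(b < n) p a b * h a b.
Proof.
move=> p0 pN.
have -> : \sum_(a < n) \sum_(b < n) p a b * h a b =
    \sum_(a < n) \sum_(b < n | (a < b)%N) p a b * h a b +
    \sum_(a < n) \sum_(b < n | (b < a)%N) p a b * h a b.
  rewrite -big_split; apply: eq_bigr => a _ /=.
  rewrite (bigID (fun b : 'I_n => (a < b)%N)) /=; congr (_ + _).
  rewrite (bigD1 a) ?ltnn //= p0 mul0r add0r; apply: eq_bigl => b.
  by rewrite -leqNgt ltn_neqAle andbC.
have -> : \sum_(a < n) \sum_(b : 'I_n | (b < a)%N) p a b * h a b =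
    - \sum_(a < n) \sum_(b : 'I_n | (a < b)%N) p a b * h b a.
  rewrite (exchange_big_dep predT) //= -sumrN; apply: eq_bigr => a _.
  by rewrite -sumrN; apply: eq_bigr => b _; rewrite pN mulNr.
rewrite -sumrB; apply: eq_bigr => a _; rewrite -sumrB.
by apply: eq_bigr => b _; rewrite mulrBr.
Qed.

Variables (R : comNzRingType) (V : vectType R).

Lemma form_inj (u v : V) : (forall eta : dual R V, eta u = eta v) -> u = v.
Proof.
move=> E; apply: (can_inj v2rK); apply/rowP=> i.
by rewrite -!stdformE.
Qed.

Lemma stdvec_expansion (u : V) : u = \sum_i stdform i u *: stdvec i.
Proof.
rewrite -[LHS]v2rK [v2r u]row_sum_delta linear_sum.
by apply: eq_bigr => i _; rewrite linearZ stdformE.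
Qed.

Lemma wedge3E (u v w : V) (x y z : dual R V) :
  @wedge R V 3 (fam [:: u; v; w]) (fam [:: x; y; z]) =
  x u * (y v * z w - z v * y w) - y u * (x v * z w - z v * x w) +
  z u * (x v * y w - y v * x w) :> R.
Proof.
rewrite /wedge (expand_det_row _ ord0) !big_ord_recl big_ord0 /cofactor.
rewrite !(expand_det_row _ ord0) !big_ord_recl !big_ord0 /cofactor !det_mx11.
rewrite !mxE /fam /= /bump /=.
set a := x u; set b := y u; set c := z u.
ring.
Qed.

End Bivectors.

Definition antisym3 (T M : zmodType) (F : T -> T -> T -> M) x y z :=
  F x y z - F x z y - F y x z + F y z x + F z x y - F z y x.

Lemma enum2 : enum 'I_2 = [:: ord0; lift ord0 ord0].
Proof. by rewrite !enum_ordSl /= (size0nil (size_enum_ord 0)). Qed.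

Lemma enum3 : enum 'I_3 = [:: ord0; lift ord0 ord0; lift ord0 (lift ord0 ord0)].
Proof. by rewrite !enum_ordSl /= (size0nil (size_enum_ord 0)). Qed.

Section Sharp.
Variables (R : comNzRingType) (V : vectType R) (P : multivec R V 2).
Hypothesis PP : extpow V 2 P.

Lemma sharp_expansion xi :
  sharp P xi = - \sum_a (\sum_b P (fam [:: stdform a; stdform b]) *
                            xi (stdvec b)) *: stdvec a.
Proof.
have bil := (altmap2P P).1 PP.
rewrite [LHS]stdvec_expansion -sumrN; apply: eq_bigr => a _.
rewrite -scaleNr; congr (_ *: _).
rewrite (sharpP _ _ PP) (abil_skew bil) {1}[xi]form_expansion (abil_sumr bil).
congr (- _); apply: eq_bigr => b _.
by rewrite (abilZr bil); exact: mulrC.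
Qed.

Lemma sharp_linear c (x y : dual R V) :
  sharp P (x + c *: y) = sharp P x + c *: sharp P y.
Proof.
have bil := (altmap2P P).1 PP.
apply: form_inj => eta; rewrite linearD linearZ /= !(sharpP _ _ PP).
by rewrite (abilDl bil) (abilZl bil).
Qed.

End Sharp.

Section SchoutenBivectors.
Variables (R : comNzRingType) (V : vectType R) (br : V -> V -> V).
Hypothesis brP : alt_bilinear br.
Variables P Q : multivec R V 2.
Hypotheses (PP : extpow V 2 P) (QP : extpow V 2 Q).

(** Contracting the coefficients of [P] and [Q] in the standard basis against
    [y] and [z] produces the two sharp maps; the sign that each contraction
    carries by [sharp_expansion] occurs twice. *)
Lemma sharp_contract (x y z : dual R V) :
  \sum_a \sum_b P (fam [:: stdform a; stdform b]) *
    (\sum_c \sum_d Q (fam [:: stdform c; stdform d]) *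
       (x (br (stdvec a) (stdvec c)) * (y (stdvec b) * z (stdvec d)))) =
  x (br (sharp P y) (sharp Q z)) :> R.
Proof.
rewrite !sharp_expansion // (abilNl brP) (abilNr brP) opprK.
rewrite (abil_suml brP) linear_sum; apply: eq_bigr => a _ /=.
rewrite (abilZl brP) linearZ (abil_sumr brP) linear_sum /=.
rewrite [RHS]mulr_suml; apply: eq_bigr => b _.
rewrite -mulrA; congr (_ * _); rewrite [RHS]mulr_sumr.
apply: eq_bigr => c _; rewrite (abilZr brP) linearZ /= [RHS]mulrA [in RHS]mulrC.
rewrite !mulr_sumr; apply: eq_bigr => d _.
ring.
Qed.

Lemma antisym3_sum n (c : 'I_n -> R)
    (F : 'I_n -> dual R V -> dual R V -> dual R V -> R) x y z :
  antisym3 (fun x y z => \sum_(i < n) c i * F i x y z) x y z =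
  \sum_(i < n) c i * antisym3 (F i) x y z.
Proof.
rewrite /antisym3 -!(sumrB, big_split) /=.
by apply: eq_bigr => i _; ring.
Qed.

Lemma sn_dec_pairsE (a c : 'I_2 -> V) (xi : 'I_3 -> dual R V)
    (W := fun u v w => @wedge R V 3 (fam [:: u; v; w]) xi : R) :
  (@sn_dec R V br 1 1 a c : multivec R V 3) xi =
  (W (br (a ord0) (c ord0)) (a ord_max) (c ord_max)
     - W (br (a ord0) (c ord_max)) (a ord_max) (c ord0))
  - (W (br (a ord_max) (c ord0)) (a ord0) (c ord_max)
     - W (br (a ord_max) (c ord_max)) (a ord0) (c ord0)).
Proof.
have omit0 (b : 'I_2 -> V) : omit ord0 b = [:: b ord_max].
  by rewrite /omit enum2 /=; congr [:: b _]; apply: val_inj.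
have omit1 (b : 'I_2 -> V) : omit ord_max b = [:: b ord0].
  by rewrite /omit enum2.
have e1 : lift ord0 ord0 = ord_max :> 'I_2 by apply: val_inj.
rewrite /sn_dec !big_ord_recl !big_ord0 !e1 !omit0 !omit1 /= !addr0.
rewrite !fctE /= /bump /= -/(W _ _ _) -/(W _ _ _) -/(W _ _ _) -/(W _ _ _).
rewrite expr0 expr1 expr2 !scale1r !scaleNr mulrNN mul1r !scale1r.
ring.
Qed.

(** Both double sums over increasing indices extend to all indices, as the four
    terms of the decomposable bracket antisymmetrize each pair; expanding the
    3x3 determinant then leaves a sum over permutations of contractions. *)
Lemma sn_bivectorsE (x y z : dual R V) :
  (sn br (P : multivec R V 1.+1) (Q : multivec R V 1.+1) : multivec R V 3)
    (fam [:: x; y; z]) =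
  antisym3 (fun x y z : dual R V => x (br (sharp P y) (sharp Q z)) : R) x y z.
Proof.
pose p a b : R := P (fam [:: stdform a; stdform b]).
pose q a b : R := Q (fam [:: stdform a; stdform b]).
pose W u v w := @wedge R V 3 (fam [:: u; v; w]) (fam [:: x; y; z]) : R.
pose H a b c d : R := W (br (stdvec a) (stdvec c)) (stdvec b) (stdvec d).
have pE I : P (@stdform R V \o I) = p (I ord0) (I ord_max).
  by rewrite [_ \o _]fam2.
have qE I : Q (@stdform R V \o I) = q (I ord0) (I ord_max).
  by rewrite [_ \o _]fam2.
have p0 a : p a a = 0 by exact: abil_alt ((altmap2P P).1 PP) _.
have q0 a : q a a = 0 by exact: abil_alt ((altmap2P Q).1 QP) _.
have pN a b : p a b = - p b a by exact: abil_skew ((altmap2P P).1 PP) _ _.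
have qN a b : q a b = - q b a by exact: abil_skew ((altmap2P Q).1 QP) _ _.
transitivity (\sum_a \sum_b p a b * \sum_c \sum_d q c d * H a b c d).
  pose G a b := \sum_(c < dim V) \sum_(d < dim V | (c < d)%N)
                  q c d * (H a b c d - H a b d c).
  have GE a b : G a b = \sum_c \sum_d q c d * H a b c d by exact: sum_skew.
  under eq_bigr do under eq_bigr do rewrite -GE.
  rewrite -sum_skew // -sum_increasing_pairs /sn fct_sumE.
  apply: eq_bigr => I _.
  rewrite fct_sumE /G -sumrB mulr_sumr.
  under [RHS]eq_bigr do rewrite -sumrB mulr_sumr.
  rewrite -sum_increasing_pairs; apply: eq_bigr => J _.
  rewrite fctE pE qE.
  apply: etrans (congr1 ( *%R _) (sn_dec_pairsE _ _ _)) _.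
  by rewrite -mulrA -mulrBr mulrBr.
(* The factors 1 put every sum in the form expected by [antisym3_sum]. *)
have -> : (fun x y z : dual R V => x (br (sharp P y) (sharp Q z)) : R) =
    fun x y z => \sum_a 1 * \sum_b p a b * (\sum_c 1 * \sum_d q c d *
      (x (br (stdvec a) (stdvec c)) * (y (stdvec b) * z (stdvec d)))).
  apply/funext=> x'; apply/funext=> y'; apply/funext=> z'.
  rewrite -sharp_contract; apply: eq_bigr => a _; rewrite mul1r.
  apply: eq_bigr => b _; congr (_ * _).
  by apply: eq_bigr => c _; rewrite mul1r.
rewrite antisym3_sum; apply: eq_bigr => a _; rewrite mul1r.
rewrite antisym3_sum; apply: eq_bigr => b _; congr (_ * _).
rewrite antisym3_sum; apply: eq_bigr => c _; rewrite mul1r.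
rewrite antisym3_sum; apply: eq_bigr => d _; congr (_ * _).
by rewrite /H /W wedge3E /antisym3; ring.
Qed.

End SchoutenBivectors.

(** * Extension of scalars to the dual numbers *)

Section DualNumberExtension.
Variable K : fieldType.

Local Notation eps := (dual_number 0 1 : dualnum K).

Lemma dual_numberD (x y x' y' : K) :
  dual_number x y + dual_number x' y' = dual_number (x + x') (y + y').
Proof.
by apply: dualnum_inj;
  rewrite poly_of_qpolyD coefD ?coef0_dual_number ?coef1_dual_number.
Qed.

Lemma coef0_eps (a b : dualnum K) :
  ((a + eps * b)%R : {poly K})`_0 = (a : {poly K})`_0.
Proof.
by rewrite poly_of_qpolyD coefD coef0_dualnumM coef0_dual_number mul0r addr0.
Qed.

Lemma coef1_eps (a b : dualnum K) :
  ((a + eps * b)%R : {poly K})`_1 = (a : {poly K})`_1 + (b : {poly K})`_0.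
Proof.
rewrite poly_of_qpolyD coefD coef1_dualnumM coef0_dual_number coef1_dual_number.
by rewrite mul0r add0r mul1r.
Qed.

Section RextModule.
Variable U : vectType K.
Implicit Types x u : U.

Lemma Rext_const_scale (c : K) x u :
  dual_number c 0 *: ((x, u) : Rext U) = ((c *: x, c *: u) : Rext U).
Proof.
congr pair; rewrite /= ?coef0_dual_number ?coef1_dual_number //.
by rewrite scale0r addr0.
Qed.

Lemma Rext_const_linear (c : K) x y :
  ((c *: x + y, 0) : Rext U) =
  dual_number c 0 *: ((x, 0) : Rext U) + ((y, 0) : Rext U).
Proof.
rewrite Rext_const_scale; congr pair => /=.
by rewrite scaler0 addr0.
Qed.

Lemma Rext_const_scale2 (c : K) (z : Rext U) :
  (dual_number c 0 *: z).2 = c *: z.2.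
Proof. by case: z => x u; rewrite Rext_const_scale. Qed.

Lemma Rext_eps_scale x u : eps *: ((x, u) : Rext U) = ((0, x) : Rext U).
Proof.
by congr pair; rewrite /= ?coef0_dual_number ?coef1_dual_number !scale0r
  ?scale1r ?add0r.
Qed.

Lemma RextD x u x' u' :
  ((x, u) : Rext U) + ((x', u') : Rext U) = ((x + x', u + u') : Rext U).
Proof. by []. Qed.

Lemma Rext_split x u :
  ((x, u) : Rext U) = ((x, 0) : Rext U) + eps *: ((u, 0) : Rext U).
Proof. by rewrite Rext_eps_scale RextD addr0 add0r. Qed.

End RextModule.

Section ExtendedBilinear.
Variables (U W : vectType K).
Implicit Types B : U -> U -> W.

(** The bilinear map over the dual numbers that takes the values [B0 + t B1] on
    constant vectors. *)
Definition ext_bilinear B0 B1 (z w : Rext U) : Rext W :=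
  (B0 z.1 w.1, B1 z.1 w.1 + (B0 z.2 w.1 + B0 z.1 w.2)).

Lemma ext_bilinear_abil B0 B1 : alt_bilinear B0 -> alt_bilinear B1 ->
  alt_bilinear (ext_bilinear B0 B1).
Proof.
move=> P0 P1; split=> [[y v] a [x u] [x' u']|[y v] a [x u] [x' u']|[x u]].
- congr pair => /=; rewrite ?(abilDl P0, abilDl P1, abilZl P0, abilZl P1) //.
  apply: form_inj => eta; rewrite !(linearD, linearZ) /=; ring.
- congr pair => /=; rewrite ?(abilDr P0, abilDr P1, abilZr P0, abilZr P1) //.
  apply: form_inj => eta; rewrite !(linearD, linearZ) /=; ring.
- congr pair => /=; rewrite ?(abil_alt P0) // (abil_alt P1) add0r.
  by rewrite (abil_skew P0) addNr.
Qed.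

End ExtendedBilinear.

(** A bilinear map over the dual numbers is determined by its values on
    constant vectors, because [t^2 = 0]. *)
Lemma abil_eps (U : vectType K) (W : lmodType (dualnum K))
    (B : Rext U -> Rext U -> W) x u y v :
  alt_bilinear B ->
  B (x, u) (y, v) =
  B (x, 0) (y, 0) + eps *: (B (u, 0) (y, 0) + B (x, 0) (v, 0)).
Proof.
move=> BP; rewrite (Rext_split x) (Rext_split y) !(abilDl BP, abilDr BP).
rewrite !(abilZl BP) !(abilZr BP) scalerA.
have -> : eps * eps = 0.
  by apply: dualnum_inj; rewrite ?coef0_dualnumM ?coef1_dualnumM
    !coef0_dual_number ?mulr0 ?mul0r ?addr0 ?coef0.
rewrite scale0r addr0 scalerDr -addrA; congr (_ + _); exact: addrC.
Qed.

Section Forms.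
Variable g : vectType K.
Implicit Types a b : dual K g.
Implicit Types xi : dual (dualnum K) (Rext g).

Lemma extform_linear (c : K) a b :
  extform (c *: a + b) = dual_number c 0 *: extform a + extform b.
Proof.
apply/lfunP=> z; rewrite lfunE /= lfunE /= !extformE !lfunE /= !lfunE /=.
rewrite -dual_number_linear.
by rewrite !coef0_dual_number !coef1_dual_number mul0r addr0.
Qed.

(** For [k] = 0 and 1, the coefficients of [xi] under the identification of the
    dual of [R (x) g] with [R (x) g^*]. *)
Definition form_coef (k : nat) xi : dual K g :=
  linfun (fun x => (xi ((x, 0) : Rext g) : {poly K})`_k : K^o).

Lemma form_coefE k xi x : (k < 2)%N ->
  form_coef k xi x = (xi ((x, 0) : Rext g) : {poly K})`_k.
Proof.
move=> k2.
have lin : linear ((fun x => (xi ((x, 0) : Rext g) : {poly K})`_k) : g -> K^o).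
  move=> c u v.
  rewrite Rext_const_linear linearD linearZ poly_of_qpolyD coefD; congr (_ + _).
  case: k k2 => [|[|]] // _; rewrite ?coef0_dualnumM ?coef1_dualnumM;
  by rewrite !coef0_dual_number ?coef1_dual_number ?mul0r ?addr0.
exact: (linfun_linearE lin).
Qed.

Lemma form_decomposition xi :
  xi = extform (form_coef 0 xi) + eps *: extform (form_coef 1 xi).
Proof.
apply/lfunP=> -[x u]; rewrite lfunE /= lfunE /= !extformE /= (Rext_split x u).
rewrite linearD linearZ /=; apply: dualnum_inj.
  by rewrite [LHS]coef0_eps [RHS]coef0_eps coef0_dual_number form_coefE.
rewrite [LHS]coef1_eps [RHS]coef1_eps coef0_dual_number coef1_dual_number.
by rewrite !form_coefE // addrC.
Qed.

Lemma form_coef_extform a :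
  form_coef 0 (extform a) = a /\ form_coef 1 (extform a) = 0.
Proof.
split; apply/lfunP=> x; rewrite form_coefE // extformE /= ?lfunE /=.
  by rewrite coef0_dual_number.
by rewrite coef1_dual_number linear0.
Qed.

Definition form_pair xi : Rext (dual K g) := (form_coef 0 xi, form_coef 1 xi).

Lemma form_pair_linear : linear form_pair.
Proof.
move=> c xi eta; congr pair; apply/lfunP=> x /=.
  rewrite add_lfunE scale_lfunE !form_coefE // add_lfunE scale_lfunE.
  by rewrite poly_of_qpolyD coefD coef0_dualnumM.
rewrite !add_lfunE !scale_lfunE !form_coefE // add_lfunE scale_lfunE.
by rewrite poly_of_qpolyD coefD coef1_dualnumM.
Qed.

End Forms.
End DualNumberExtension.

(** * Low-degree coboundaries *)

Section CoboundaryFormulas.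
Variables (R : comNzRingType) (V : vectType R) (A : tlb V).
Local Notation "[ x , y ]" := (lie A x y).
Local Notation r := (rmx A).

Lemma d_CE1E (f : multimap V 1) x y :
  d_CE A f (fam [:: x; y]) =
  [x, f (fam [:: y])] - [y, f (fam [:: x])] - f (fam [:: [x, y]]).
Proof.
rewrite /d_CE.
under [X in _ + X]eq_bigr do rewrite big_mkcond.
rewrite !big_ord_recl !big_ord0 /omit /omit2 enum2 /= /bump /=.
rewrite -[fam [:: x; y] ord0]/x -[fam [:: x; y] (lift ord0 ord0)]/y.
rewrite -!(signr_odd _ (_ + _)) /= expr0 expr1 !(addr0, add0r).
by rewrite !(scale1r, scaleN1r).
Qed.

Lemma d_CE2E (f : multimap V 2) x y z :
  d_CE A f (fam [:: x; y; z]) =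
  [x, f (fam [:: y; z])] - [y, f (fam [:: x; z])] + [z, f (fam [:: x; y])]
  - f (fam [:: [x, y]; z]) + f (fam [:: [x, z]; y]) - f (fam [:: [y, z]; x]).
Proof.
rewrite /d_CE.
under [X in _ + X]eq_bigr do rewrite big_mkcond.
rewrite !big_ord_recl !big_ord0 /omit /omit2 enum3 /= /bump /=.
rewrite -[fam [:: x; y; z] ord0]/x -[fam [:: x; y; z] (lift ord0 ord0)]/y.
rewrite -[fam [:: x; y; z] (lift _ _)]/z.
rewrite -!(signr_odd _ (_ + _)) /= expr0 expr1 !(addr0, add0r).
by rewrite !(scale1r, scaleN1r) !addrA.
Qed.

Lemma Theta1E (f : multimap V 1) (x y : dual R V) :
  Theta A f (fam [:: x; y]) =
  x (f (fam [:: sharp r y])) - y (f (fam [:: sharp r x])).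
Proof.
have famE u : sharp r \o fam [:: u] = fam [:: sharp r u] :> ('I_1 -> V).
  by rewrite [LHS]fam1.
rewrite /Theta !big_ord_recl !big_ord0 /omit enum2 /= !famE.
by rewrite expr0 expr1 scale1r scaleN1r addr0.
Qed.

Lemma Theta2E (f : multimap V 2) (x y z : dual R V) :
  Theta A f (fam [:: x; y; z]) =
  x (f (fam [:: sharp r y; sharp r z])) - y (f (fam [:: sharp r x; sharp r z]))
  + z (f (fam [:: sharp r x; sharp r y])).
Proof.
have famE u v :
    sharp r \o fam [:: u; v] = fam [:: sharp r u; sharp r v] :> ('I_2 -> V).
  by rewrite [LHS]fam2.
rewrite /Theta !big_ord_recl !big_ord0 /omit enum3 /= !famE /bump /=.
rewrite -!(signr_odd _ (_ + _)) /= expr0 expr1 addr0.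
by rewrite !(scale1r, scaleN1r) addrA.
Qed.

Section PolarizedSchouten.
Variables (w : V -> V -> V) (chi : multivec R V 2).
Hypotheses (wP : alt_bilinear w) (chiP : extpow V 2 chi).

(** The Schouten square of [r] formed with [w] in place of the bracket is
    [2 Theta w]: exchanging the last two arguments changes both the sign of the
    permutation and that of [w], so the six terms agree in pairs. *)
Lemma antisym3_Theta x y z :
  antisym3 (fun x y z : dual R V => x (w (sharp r y) (sharp r z)) : R) x y z =
  Theta A (fun u : 'I_2 -> V => w (u ord0) (u ord_max)) (fam [:: x; y; z]) *+ 2.
Proof.
rewrite Theta2E /antisym3 !(abil_skew wP _ (sharp r x)).
rewrite (abil_skew wP _ (sharp r y)).
rewrite !linearN mulr2n /=.
set a := x _; set b := y _; set c := z _.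
ring.
Qed.

(** Polarization of the Schouten square: the two mixed brackets of [r] and
    [chi] coincide by skew-symmetry of the Lie bracket. *)
Lemma antisym3_d_r x y z :
  antisym3 (fun x y z : dual R V =>
    x ([sharp chi y, sharp r z] + [sharp r y, sharp chi z]) : R) x y z =
  (d_r A (chi : multivec R V 1.+1) : multivec R V 3) (fam [:: x; y; z]) *+ 2.
Proof.
have lP := lie_abil (lieP A).
rewrite /d_r sn_bivectorsE //; last exact: rmx_skew.
rewrite /antisym3 ![[sharp chi _, _]](abil_skew lP) !linearD !linearN /= mulr2n.
ring.
Qed.

End PolarizedSchouten.

End CoboundaryFormulas.

(** * The deformation equations *)

Section DeformationEquations.
Variables (K : fieldType) (g : vectType K) (A : tlb g).
Local Notation "[ x , y ]" := (lie A x y).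
Local Notation r := (rmx A).

Lemma dual_numberB (x y x' y' : K) :
  dual_number x y - dual_number x' y' = dual_number (x - x') (y - y').
Proof. by apply/eqP; rewrite subr_eq dual_numberD !subrK. Qed.

Lemma dual_number00 : dual_number 0 0 = 0 :> dualnum K.
Proof. by rewrite /dual_number !scale0r addr0. Qed.

Section Bracket.
Variable w : g -> g -> g.
Hypothesis wP : alt_bilinear w.

(** The constant term of the Jacobi sum is the Jacobi sum of [g], and its
    t-coefficient is [d_CE w] plus three Jacobi sums of [g], one for each
    argument replaced by its t-coefficient. *)
Lemma ext_lie_bracketP :
  is_lie_bracket (ext_bilinear (lie A) w) <->
  d_CE A (fun u : 'I_2 -> g => w (u ord0) (u ord_max)) = 0.
Proof.
have lP := lie_abil (lieP A).
pose br := ext_bilinear (lie A) w.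
have brP : alt_bilinear br by exact: ext_bilinear_abil.
have jac x y z u v t : br (x, u) (br (y, v) (z, t)) +
    br (y, v) (br (z, t) (x, u)) + br (z, t) (br (x, u) (y, v)) =
    ((0, d_CE A (fun u : 'I_2 -> g => w (u ord0) (u ord_max))
           (fam [:: x; y; z])) : Rext g).
  congr pair; first exact: (lie_jacobi (lieP A)).
  rewrite d_CE2E /fam /=.
  rewrite !(abilDr lP) (abil_skew wP [x, y]) (abil_skew wP [y, z]).
  rewrite (abil_skew lP x z) (abilNl wP) (abil_skew wP [z, x] y) opprK.
  have J1 := lie_jacobi (lieP A) u y z.
  have J2 := lie_jacobi (lieP A) x v z.
  have J3 := lie_jacobi (lieP A) x y t.
  apply: form_inj => eta.
  move: (congr1 eta J1) (congr1 eta J2) (congr1 eta J3).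
  rewrite (abil_skew wP x z) (abilNr lP).
  rewrite !(linearD, linearN, linear0) /= => E1 E2 E3.
  (* Add the three vanishing Jacobi sums to the right-hand side. *)
  rewrite -[RHS]addr0 -[RHS]addr0 -[RHS]addr0.
  rewrite -[in X in _ = _ + X]E3 -[in X in _ = _ + X + _]E2.
  rewrite -[in X in _ = _ + X + _ + _]E1.
  ring.
split=> [[_ _ _ J]|dw].
  apply/funext=> x; have [a [b [c ->]]] := fam3 x.
  by have := J (a, 0) (b, 0) (c, 0); rewrite jac => -[].
case: brP => bl br' ba; split=> //.
by move=> [x u] [y v] [z t]; rewrite jac dw.
Qed.

End Bracket.

Section RMatrix.
Variables (w : g -> g -> g) (chi : multivec K g 2).
Variable X : multivec (dualnum K) (Rext g) 2.
Hypotheses (wP : alt_bilinear w) (chiP : extpow g 2 chi).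
Hypothesis XP : extpow (Rext g) 2 X.
Hypothesis XE : forall a b, X (fam [:: extform a; extform b]) =
  dual_number (r (fam [:: a; b])) (chi (fam [:: a; b])).

Lemma sharp_extform a :
  sharp X (extform a) = ((sharp r a, sharp chi a) : Rext g).
Proof.
have E (b : dual K g) :
    dual_number (b (sharp X (extform a)).1) (b (sharp X (extform a)).2) =
    dual_number (b (sharp r a)) (b (sharp chi a)).
  rewrite -(extformE b (sharp X _)) (sharpP _ _ XP) XE !sharpP //.
  exact: rmx_skew.
rewrite [LHS]surjective_pairing; congr pair; apply: form_inj => b.
  by have := congr1 (fun c : dualnum K => (c : {poly K})`_0) (E b);
    rewrite !coef0_dual_number.
by have := congr1 (fun c : dualnum K => (c : {poly K})`_1) (E b);
  rewrite !coef1_dual_number.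
Qed.

Local Notation br := (ext_bilinear (lie A) w).
Local Notation snX := (sn br (X : multivec (dualnum K) (Rext g) 1.+1)
   (X : multivec (dualnum K) (Rext g) 1.+1) : multivec (dualnum K) (Rext g) 3).

(** The t-coefficient of [xi (br (X# eta) (X# zeta))] has one summand in [w]
    and two in [chi]; their alternating sums are [2 Theta w] and
    [2 d_r chi]. *)
Lemma sn_extform a b c :
  snX (fam [:: extform a; extform b; extform c]) =
  dual_number 0 ((Theta A (fun u : 'I_2 -> g => w (u ord0) (u ord_max)) +
    d_r A (chi : multivec K g 1.+1)) (fam [:: a; b; c]) *+ 2).
Proof.
have lP := lie_abil (lieP A).
rewrite sn_bivectorsE //; last exact: ext_bilinear_abil.
pose T0 (a b c : dual K g) : K := a [sharp r b, sharp r c].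
pose T1 (a b c : dual K g) : K := a (w (sharp r b) (sharp r c)).
pose T2 (a b c : dual K g) : K :=
  a ([sharp chi b, sharp r c] + [sharp r b, sharp chi c]).
have E a' b' c' :
    extform a' (br (sharp X (extform b')) (sharp X (extform c'))) =
    dual_number (T0 a' b' c') (T1 a' b' c' + T2 a' b' c').
  by rewrite !sharp_extform extformE /= linearD.
rewrite /antisym3 !E !(dual_numberB, dual_numberD); congr dual_number.
  transitivity (antisym3 T0 a b c); first by [].
  by rewrite -sn_bivectorsE //; [rewrite rmxP | exact: rmx_skew..].
rewrite mulrnDl -antisym3_Theta // -antisym3_d_r //.
rewrite -/(antisym3 T1 a b c).
transitivity (antisym3 T1 a b c + antisym3 T2 a b c); last by [].
by rewrite /antisym3; ring.
Qed.

(** The Schouten square is linear in each form over the dual numbers, and these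
    are combinations of forms extended from [g]. *)
Lemma sn_extform_vanish :
  (forall a b c, snX (fam [:: extform a; extform b; extform c]) = 0) -> snX = 0.
Proof.
have brP : alt_bilinear br.
  by apply: ext_bilinear_abil => //; exact/lie_abil/lieP.
pose T (x y z : dual (dualnum K) (Rext g)) : dualnum K :=
  x (br (sharp X y) (sharp X z)).
have T1 c x x' y z : T (x + c *: x') y z = T x y z + c * T x' y z.
  by rewrite /T add_lfunE scale_lfunE.
have T2 c x y y' z : T x (y + c *: y') z = T x y z + c * T x y' z.
  by rewrite /T (sharp_linear XP) (abilDl brP) (abilZl brP) linearD linearZ.
have T3 c x y z z' : T x y (z + c *: z') = T x y z + c * T x y z'.
  by rewrite /T (sharp_linear XP) (abilDr brP) (abilZr brP) linearD linearZ.
move=> E; apply/funext=> xi; have [x [y [z ->]]] := fam3 xi.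
rewrite sn_bivectorsE // -[LHS]/(antisym3 T x y z).
have {}E a b c : antisym3 T (extform a) (extform b) (extform c) = 0.
  by rewrite -(E a b c) sn_bivectorsE.
have A1 c x' x'' y' z' : antisym3 T (x' + c *: x'') y' z' =
    antisym3 T x' y' z' + c * antisym3 T x'' y' z'.
  by rewrite /antisym3 !T1 !T2 !T3; ring.
have A2 c x' y' y'' z' : antisym3 T x' (y' + c *: y'') z' =
    antisym3 T x' y' z' + c * antisym3 T x' y'' z'.
  by rewrite /antisym3 !T1 !T2 !T3; ring.
have A3 c x' y' z' z'' : antisym3 T x' y' (z' + c *: z'') =
    antisym3 T x' y' z' + c * antisym3 T x' y' z''.
  by rewrite /antisym3 !T1 !T2 !T3; ring.
rewrite (form_decomposition x) (form_decomposition y) (form_decomposition z).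
by rewrite !A1 !A2 !A3 !E !(mulr0, addr0).
Qed.

End RMatrix.

End DeformationEquations.

(** * Deformations and cocycles *)

Section EpsilonPart.
Variables (K : fieldType) (g : vectType K).
Implicit Types D : tlb (Rext g).

Definition lie_coef D (x y : g) : g :=
  (lie D ((x, 0) : Rext g) ((y, 0) : Rext g)).2.

Definition eps_lie D : multimap g 2 := fun u => lie_coef D (u ord0) (u ord_max).

Definition eps_rmx D : multivec K g 2 :=
  fun xi => (rmx D (@extform K g \o xi) : {poly K})`_1.

Definition eps_part D : multimap g 2 * multivec K g 2 := (eps_lie D, eps_rmx D).

Lemma extform_fam2 (a b : dual K g) :
  @extform K g \o fam [:: a; b] = fam [:: extform a; extform b] :> ('I_2 -> _).
Proof. by rewrite [LHS]fam2. Qed.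

Lemma lie_coef_abil D : alt_bilinear (lie_coef D).
Proof.
have lP := lie_abil (lieP D).
split=> [y c x x'|x c y y'|x]; rewrite /lie_coef ?(lie_alt (lieP D)) //.
  by rewrite Rext_const_linear (abilDl lP) (abilZl lP) -Rext_const_scale2.
by rewrite Rext_const_linear (abilDr lP) (abilZr lP) -Rext_const_scale2.
Qed.

Lemma eps_lie_alt D : altmap 2 g g (eps_lie D).
Proof. exact: altmap2_of (lie_coef_abil D). Qed.

Lemma eps_rmx_skew D : extpow g 2 (eps_rmx D).
Proof.
have bil := (altmap2P (rmx D)).1 (rmx_skew D).
have coefE c (x y : dualnum K) : ((dual_number c 0 * x + y)%R : {poly K})`_1 =
    c * (x : {poly K})`_1 + (y : {poly K})`_1.
  rewrite poly_of_qpolyD coefD coef1_dualnumM coef0_dual_number.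
  by rewrite coef1_dual_number mul0r addr0.
apply/altmap2P; split=> [b c a a'|a c b b'|a]; rewrite /eps_rmx !extform_fam2.
- by rewrite extform_linear (abilDl bil) (abilZl bil) coefE.
- by rewrite extform_linear (abilDr bil) (abilZr bil) coefE.
- by rewrite (abil_alt bil) coef0.
Qed.

End EpsilonPart.

Section Deformations.
Variables (K : fieldType) (g : vectType K) (A : tlb g).
Implicit Types D : tlb (Rext g).
Local Notation r := (rmx A).

Lemma deformation_lieE D : deformation A D ->
  lie D = ext_bilinear (lie A) (lie_coef D).
Proof.
move=> [dl _]; have lP := lie_abil (lieP D).
apply/funext=> -[x u]; apply/funext=> -[y v].
rewrite (abil_eps _ _ _ _ lP).
rewrite [lie D (u, 0) (y, 0)]surjective_pairing.
rewrite [lie D (x, 0) (v, 0)]surjective_pairing.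
rewrite -[(lie D (u, 0) _).1]/(red _) -[(lie D (x, 0) (v, 0)).1]/(red _).
rewrite !dl /red /=.
rewrite RextD Rext_eps_scale [lie D _ _]surjective_pairing.
by rewrite -[(lie D _ _).1]/(red _) dl RextD addr0.
Qed.

Lemma deformation_rmxE D a b : deformation A D ->
  rmx D (fam [:: extform a; extform b]) =
  dual_number (r (fam [:: a; b])) (eps_rmx D (fam [:: a; b])).
Proof.
move=> [_ <-]; apply: dualnum_inj.
  by rewrite coef0_dual_number /red2 extform_fam2.
by rewrite coef1_dual_number /eps_rmx extform_fam2.
Qed.

Lemma eps_part_cocycle D : (2%:R : K) != 0 -> deformation A D ->
  tlb_cocycle A 2 (eps_part D).
Proof.
move=> char2 dD; split.
  by split=> //; [exact: eps_lie_alt | exact: eps_rmx_skew].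
have wP := lie_coef_abil D.
rewrite /= -[RHS]/((0, 0) : multimap g 3 * multivec K g 3); congr pair.
  by apply/(ext_lie_bracketP A wP); rewrite -deformation_lieE //; exact: lieP.
apply/funext=> xi; have [a [b [c ->]]] := fam3 xi.
have := sn_extform wP (eps_rmx_skew D) (rmx_skew D)
  (fun a b => deformation_rmxE a b dD) a b c.
rewrite -deformation_lieE // rmxP.
move=> /(congr1 (fun c : dualnum K => (c : {poly K})`_1)).
rewrite coef1_dual_number coef0 -mulr_natr => /esym/eqP.
by rewrite mulf_eq0 (negPf char2) orbF => /eqP.
Qed.

(** The bracket is [ext_bilinear (lie A) w].  The r-matrix is the same extension
    of [r] and [chi], read through the identification of the dual of
    [R (x) g] with [R (x) g^*]. *)
Lemma cocycle_eps_part z : tlb_cocycle A 2 z ->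
  exists2 D, deformation A D & eps_part D = z.
Proof.
case: z => f chi [[/= falt chiP _ _] /= [df dchi]].
have rP := rmx_skew A.
pose w x y := f (fam [:: x; y]).
have wP : alt_bilinear w by apply/altmap2P.
have fE : f = fun u => w (u ord0) (u ord_max).
  by apply/funext=> u; rewrite {1}[u]fam2.
have brP : is_lie_bracket (ext_bilinear (lie A) w).
  by apply/(ext_lie_bracketP A wP); rewrite -fE.
pose R2 a b : K^o := r (fam [:: a; b]).
pose C2 a b : K^o := chi (fam [:: a; b]).
pose XB (x y : dual (dualnum K) (Rext g)) : (dualnum K)^o :=
  let z := ext_bilinear R2 C2 (form_pair x) (form_pair y) in
  dual_number z.1 z.2.
have XBP : alt_bilinear XB.
  have bil : alt_bilinear (ext_bilinear R2 C2).
    by apply: ext_bilinear_abil; exact: (altmap2P _).1.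
  split=> [y c x x'|x c y y'|x]; rewrite /XB.
  - rewrite (form_pair_linear c x x') (abilDl bil) (abilZl bil).
    by rewrite -dual_number_linear.
  - rewrite (form_pair_linear c y y') (abilDr bil) (abilZr bil).
    by rewrite -dual_number_linear.
  - by rewrite (abil_alt bil) dual_number00.
pose X : multivec (dualnum K) (Rext g) 2 := fun x => XB (x ord0) (x ord_max).
have XP : extpow (Rext g) 2 X by exact: altmap2_of.
have XE a b : X (fam [:: extform a; extform b]) =
    dual_number (r (fam [:: a; b])) (chi (fam [:: a; b])).
  rewrite /X /XB /fam /= /form_pair.
  have [-> ->] := form_coef_extform a; have [-> ->] := form_coef_extform b.
  rewrite /ext_bilinear /=; congr dual_number.
  have bil := (altmap2P _).1 rP.
  by rewrite /R2 (abil0l bil) (abil0r bil) !addr0.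
have snX : sn (ext_bilinear (lie A) w) (X : multivec _ _ 1.+1)
    (X : multivec _ _ 1.+1) = 0.
  apply: (sn_extform_vanish wP XP) => a b c.
  by rewrite (sn_extform wP chiP XP XE) -fE dchi mul0rn dual_number00.
pose D := TLB brP XP snX.
exists D; first split=> //.
  apply/funext=> xi; rewrite [xi]fam2 /red2 extform_fam2.
  rewrite -[rmx D]/X XE; exact: coef0_dual_number.
congr pair; apply/funext=> u; rewrite [u]fam2.
  rewrite /eps_lie /lie_coef /= /ext_bilinear /=.
  have lP := lie_abil (lieP A).
  by rewrite (abil0l lP) (abil0r lP) !addr0.
by rewrite /eps_rmx extform_fam2 -[rmx D]/X XE coef1_dual_number.
Qed.

End Deformations.

(** * Transport along linear isomorphisms *)

Lemma tens2_fam (R : comNzRingType) (U V : vectType R) (phi : 'Hom(U, V)) P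
    (a b : dual R V) :
  tens2 phi P (fam [:: a; b]) = P (fam [:: (a \o phi)%VF; (b \o phi)%VF]).
Proof. by rewrite /tens2; congr P; rewrite [LHS]fam2. Qed.

Lemma tens2_skew (R : comNzRingType) (U V : vectType R) (phi : 'Hom(U, V)) P :
  extpow U 2 P -> extpow V 2 (tens2 phi P).
Proof.
move=> /altmap2P PB; apply/altmap2P.
by split=> [b c a a'|a c b b'|a]; rewrite !tens2_fam
  ?comp_lfunDl -?comp_lfunZl ?(abilDl PB, abilZl PB) ?(abilDr PB, abilZr PB)
  ?(abil_alt PB).
Qed.

Lemma sharp_tens2 (R : comNzRingType) (U V : vectType R) (phi : 'Hom(U, V)) P
    (xi : dual R V) :
  extpow U 2 P -> sharp (tens2 phi P) xi = phi (sharp P (xi \o phi)%VF).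
Proof.
move=> PP; apply: form_inj => eta.
rewrite (sharpP _ _ (tens2_skew phi PP)) tens2_fam -(sharpP _ _ PP).
exact: comp_lfunE.
Qed.

(** By [sharp_tens2] and [sn_bivectorsE], the Schouten square of the pulled-back
    bivector at given forms is the original one at their pullbacks by [psi]. *)
Lemma tlb_pullback (R : comNzRingType) (U V : vectType R) (B : tlb V)
    (phi : 'Hom(U, V)) (psi : 'Hom(V, U)) :
  cancel phi psi -> cancel psi phi -> exists B' : tlb U, tlb_hom B' B phi.
Proof.
move=> phiK psiK; have lP := lieP B; have lB := lie_abil lP.
pose br x y := psi (lie B (phi x) (phi y)).
have brP : is_lie_bracket br.
  split=> [y c x x'|x c y y'|x|x y z]; rewrite /br.
  - by rewrite linearP (abilDl lB) (abilZl lB) linearP.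
  - by rewrite linearP (abilDr lB) (abilZr lB) linearP.
  - by rewrite (lie_alt lP) linear0.
  - by rewrite !psiK -!linearD (lie_jacobi lP) linear0.
have XP := tens2_skew psi (rmx_skew B).
have snX : sn br (tens2 psi (rmx B) : multivec R U 1.+1)
    (tens2 psi (rmx B) : multivec R U 1.+1) = 0.
  apply/funext=> xi; have [a [b [c ->]]] := fam3 xi.
  rewrite (sn_bivectorsE (lie_abil brP)) // /br.
  rewrite /antisym3 !(sharp_tens2 _ _ (rmx_skew B)) !psiK -!comp_lfunE.
  have := sn_bivectorsE lB (rmx_skew B) (rmx_skew B)
    (a \o psi)%VF (b \o psi)%VF (c \o psi)%VF.
  by rewrite rmxP.
exists (TLB brP XP snX); split=> [x y|] /=; first exact: psiK.
apply/funext=> xi; rewrite [xi]fam2 !tens2_fam -!comp_lfunA.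
have -> : (phi \o psi)%VF = \1%VF.
  by apply/lfunP=> x; rewrite comp_lfunE id_lfunE.
by rewrite !comp_lfun1r.
Qed.

(** * Equivalences and coboundaries *)

Section Equivalence.
Variables (K : fieldType) (g : vectType K).
Implicit Types (N : 'Hom(g, g)) (D : tlb (Rext g)).
Local Notation eps := (dual_number 0 1 : dualnum K).

Definition is_shear N (phi : 'Hom(Rext g, Rext g)) :=
  forall z, phi z = ((z.1, z.2 + N z.1) : Rext g).

Lemma shear_exists N : exists phi, is_shear N phi.
Proof.
exists (linfun (fun z : Rext g => (z.1, z.2 + N z.1) : Rext g)).
apply: linfun_linearE => c [x u] [y v]; congr pair => /=.
rewrite linearD linearZ /=; apply: form_inj => eta.
by rewrite !(linearD, linearZ) /=; ring.
Qed.

Lemma shear_bij N phi : is_shear N phi -> bijective phi.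
Proof.
move=> phiE; exists (fun z => ((z.1, z.2 - N z.1) : Rext g)) => -[x u].
  by rewrite phiE /= addrK.
by rewrite phiE /= subrK.
Qed.

(** A linear map over the dual numbers commutes with [t], so it acts on [t g]
    through its reduction, here the identity; [N] is its t-coefficient on
    constant vectors. *)
Lemma red_shear (phi : 'Hom(Rext g, Rext g)) :
  (forall z, red (phi z) = red z) -> exists N, is_shear N phi.
Proof.
move=> phir.
have lin : linear (fun x : g => (phi ((x, 0) : Rext g)).2).
  move=> c x y.
  by rewrite Rext_const_linear linearD linearZ -Rext_const_scale2.
pose N : 'Hom(g, g) := linfun (fun x : g => (phi ((x, 0) : Rext g)).2).
have NE : forall x, N x = _ := linfun_linearE lin.
exists N => -[x u].
rewrite [in LHS](Rext_split x) linearD linearZ /=.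
rewrite [phi (x, 0)]surjective_pairing [phi (u, 0)]surjective_pairing -NE.
rewrite -[(phi (x, 0)).1]/(red _) -[(phi (u, 0)).1]/(red _) !phir /red /=.
by rewrite Rext_eps_scale RextD addr0 addrC.
Qed.

Lemma extform_shear N phi (a : dual K g) : is_shear N phi ->
  (extform a \o phi)%VF = extform a + eps *: extform (a \o N)%VF.
Proof.
move=> phiE; apply/lfunP=> -[x u].
rewrite comp_lfunE phiE add_lfunE scale_lfunE !extformE /= !comp_lfunE linearD.
apply: dualnum_inj.
  by rewrite [RHS]coef0_eps !coef0_dual_number.
by rewrite [RHS]coef1_eps !coef1_dual_number coef0_dual_number.
Qed.

Lemma extpow2_ext (X Y : multivec (dualnum K) (Rext g) 2) :
  extpow (Rext g) 2 X -> extpow (Rext g) 2 Y ->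
  (forall a b, X (fam [:: extform a; extform b]) =
               Y (fam [:: extform a; extform b])) -> X = Y.
Proof.
move=> /altmap2P XB /altmap2P YB E; apply/funext=> xi; rewrite [xi]fam2.
rewrite (form_decomposition (xi ord0)) (form_decomposition (xi ord_max)).
rewrite (abilDl XB) (abilZl XB) !(abilDr XB) !(abilZr XB).
rewrite (abilDl YB) (abilZl YB) !(abilDr YB) !(abilZr YB).
by do 4 rewrite E.
Qed.

Lemma red2_shear N phi X : is_shear N phi -> extpow (Rext g) 2 X ->
  red2 (tens2 phi X) = red2 X.
Proof.
move=> phiE /altmap2P XB; apply/funext=> xi; rewrite [xi]fam2 /red2.
rewrite extform_fam2 tens2_fam !(extform_shear _ phiE).
rewrite (abilDl XB) (abilZl XB) !(abilDr XB) !(abilZr XB).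
by rewrite -addrA -scalerDr; exact: coef0_eps.
Qed.

Variable A : tlb g.
Local Notation "[ x , y ]" := (lie A x y).
Local Notation r := (rmx A).

Lemma d_r0 n : d_r A (0 : multivec K g n.+1) = 0.
Proof.
rewrite /d_r /sn big1 // => I _; rewrite big1 // => J _.
by rewrite mulr0 scale0r.
Qed.

Definition shear_coboundary N : multimap g 2 * multivec K g 2 :=
  tlb_D A ((fun u : 'I_1 -> g => N (u ord0)), (0 : multivec K g 1)).

Lemma shear_coboundary1E N x y :
  (shear_coboundary N).1 (fam [:: x; y]) = [x, N y] - [y, N x] - N [x, y].
Proof. exact: (d_CE1E A). Qed.

Lemma shear_coboundary2E N (a b : dual K g) :
  (shear_coboundary N).2 (fam [:: a; b]) =
  a (N (sharp r b)) - b (N (sharp r a)).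
Proof. by rewrite /shear_coboundary /= d_r0 addr0; exact: (Theta1E A). Qed.

Lemma shear_coboundaryB N N' :
  shear_coboundary (N - N') = shear_coboundary N - shear_coboundary N'.
Proof.
have lP := lie_abil (lieP A).
apply: injective_projections; apply/funext=> u; rewrite [u]fam2.
  apply: etrans (shear_coboundary1E _ _ _) _; apply: esym.
  apply: etrans (congr2 (fun p q => p - q) (shear_coboundary1E _ _ _)
                   (shear_coboundary1E _ _ _)) _.
  rewrite !add_lfunE !opp_lfunE !(abilDr lP) !(abilNr lP).
  by apply: form_inj => eta; rewrite !(linearD, linearN) /=; ring.
apply: etrans (shear_coboundary2E _ _ _) _; apply: esym.
apply: etrans (congr2 (fun p q => p - q) (shear_coboundary2E _ _ _)
                 (shear_coboundary2E _ _ _)) _.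
by rewrite !add_lfunE !opp_lfunE !(linearD, linearN) /=; ring.
Qed.

(** A cochain of degree 1 is an endomorphism of [g]. *)
Lemma shear_coboundaryP z :
  tlb_coboundary A 2 z <-> exists N, z = shear_coboundary N.
Proof.
split=> [[[f chi] [/= /altmap1P flin _ _ chi0] <-]|[N ->]].
  pose N : 'Hom(g, g) := linfun (fun x => f (fam [:: x])).
  have NE : forall x, N x = _ := linfun_linearE flin.
  exists N; rewrite chi0 //.
  have -> // : f = fun u => N (u ord0).
  by apply/funext=> u; rewrite NE {1}[u]fam1.
exists ((fun u : 'I_1 -> g => N (u ord0)), (0 : multivec K g 1)) => //.
split=> //=; first by apply/altmap1P => c x y; rewrite /= linearP.
apply/altmap1P => c a b; rewrite -[RHS]/(c *: (0 : K^o) + 0).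
by rewrite scaler0 addr0.
Qed.

(** Compare t-coefficients, writing [(w, chi)] and [(w', chi')] for the t-parts
    of [D] and [D'].  On constant vectors, compatibility with the
    brackets is [w' (x, y) + N [x, y] = w (x, y) + [N x, y] + [x, N y]].  On
    forms extended from [g], compatibility with the r-matrices is
    [chi' (a, b) + r (a N, b) + r (a, b N) = chi (a, b)], where
    [r (a, b N) = b (N (r# a))] and [r (a N, b) = - a (N (r# b))]. *)
Lemma shear_homP D D' N phi : is_shear N phi ->
  deformation A D -> deformation A D' ->
  tlb_hom D' D phi <-> eps_part D' - eps_part D = shear_coboundary N.
Proof.
move=> phiE dD dD'.
have lP := lie_abil (lieP A); have rP := (altmap2P _).1 (rmx_skew A).
have lieE : (forall z w, phi (lie D' z w) = lie D (phi z) (phi w)) <->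
    forall x y,
      lie_coef D' x y - lie_coef D x y = [x, N y] - [y, N x] - N [x, y].
  rewrite (deformation_lieE dD) (deformation_lieE dD').
  have red_eq x y :
      lie_coef D' x y - lie_coef D x y = [x, N y] - [y, N x] - N [x, y] <->
      lie_coef D' x y + N [x, y] = lie_coef D x y + ([N x, y] + [x, N y]).
    rewrite (abil_skew lP y) opprK; split=> E.
      apply/eqP; rewrite -subr_eq0 opprD addrACA E; apply/eqP.
      by apply: form_inj => eta; rewrite !(linearD, linearN, linear0) /=; ring.
    apply/eqP; rewrite subr_eq -[_ - N _ + _]addrAC eq_sym subr_eq eq_sym E.
    by apply/eqP; rewrite addrC (addrC [N x, y]).
  split=> [E x y|E [x u] [y v]].
    apply/red_eq; have := congr1 snd (E (x, 0) (y, 0)).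
    rewrite !phiE /ext_bilinear /= !add0r.
    by rewrite (abil0l lP) (abil0r lP) !addr0.
  rewrite !phiE /ext_bilinear /=; congr pair.
  have {}E := (red_eq _ _).1 (E x y).
  rewrite (abilDl lP) (abilDr lP) addrAC E.
  by apply: form_inj => eta; rewrite !linearD /=; ring.
have rmxE : tens2 phi (rmx D') = rmx D <-> forall a b : dual K g,
    eps_rmx D' (fam [:: a; b]) - eps_rmx D (fam [:: a; b]) =
    a (N (sharp r b)) - b (N (sharp r a)).
  have bil := (altmap2P (rmx D')).1 (rmx_skew D').
  have tensE (a b : dual K g) :
      tens2 phi (rmx D') (fam [:: extform a; extform b]) =
      dual_number (r (fam [:: a; b])) (eps_rmx D' (fam [:: a; b]) +
        (b (N (sharp r a)) - a (N (sharp r b)))).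
    rewrite tens2_fam.
    rewrite !(extform_shear _ phiE) -!comp_lfunE !(sharpP _ _ (rmx_skew A)).
    rewrite (abilDl bil) (abilZl bil) !(abilDr bil) !(abilZr bil).
    rewrite !(deformation_rmxE _ _ dD') (abil_skew rP b).
    apply: dualnum_inj.
      by rewrite -addrA -scalerDr [LHS]coef0_eps !coef0_dual_number.
    rewrite [LHS]coef1_eps [X in X + _]coef1_eps [X in _ + X = _]coef0_eps.
    by rewrite !coef0_dual_number !coef1_dual_number opprK addrA.
  split=> [E a b|E].
    have /(congr1 (fun c : dualnum K => (c : {poly K})`_1)) := tensE a b.
    rewrite E (deformation_rmxE _ _ dD) !coef1_dual_number => ->.
    ring.
  apply: extpow2_ext => [||a b]; [exact/tens2_skew/rmx_skew|exact: rmx_skew|].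
  rewrite tensE (deformation_rmxE _ _ dD); congr dual_number.
  by have := E a b; rewrite -[b _ - _]opprB => <-; rewrite subKr.
split=> [[/lieE EL /rmxE ER]|E].
  apply: injective_projections; apply/funext=> u; rewrite [u]fam2.
    by rewrite shear_coboundary1E; exact: EL.
  by rewrite shear_coboundary2E; exact: ER.
split.
  by apply/lieE => x y; rewrite -shear_coboundary1E -E.
by apply/rmxE => a b; rewrite -shear_coboundary2E -E.
Qed.

Lemma shear_pullback D N phi : is_shear N phi -> deformation A D ->
  exists2 D', deformation A D' & tlb_hom D' D phi.
Proof.
move=> phiE [dl dr]; have [psi psiE] := shear_exists (- N).
have phiK : cancel phi psi.
  by move=> [x u]; rewrite phiE psiE opp_lfunE /= addrK.
have psiK : cancel psi phi.
  by move=> [x u]; rewrite psiE phiE opp_lfunE /= subrK.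
have [D' [hl hr]] := tlb_pullback D phiK psiK.
have phir z : red (phi z) = red z by rewrite phiE.
exists D' => //; split=> [x y|].
  by rewrite -phir hl dl !phir.
by rewrite -dr -hr (red2_shear phiE) //; exact: rmx_skew.
Qed.

Lemma equivalentP D D' : deformation A D -> deformation A D' ->
  equivalent D D' <-> tlb_coboundary A 2 (eps_part D' - eps_part D).
Proof.
move=> dD dD'; rewrite shear_coboundaryP; split.
  move=> [phi [[hom _] /red_shear[N phiE]]]; exists N.
  exact/(shear_homP phiE dD dD').
move=> [N /= E]; have [phi phiE] := shear_exists N.
exists phi; split; last by move=> z; rewrite phiE.
by split; [exact/(shear_homP phiE dD dD') | exact: shear_bij phiE].
Qed.

Lemma coboundary0 : tlb_coboundary A 2 0.
Proof.
apply/shear_coboundaryP; exists 0.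
by rewrite -[X in shear_coboundary X](subrr 0) shear_coboundaryB subrr.
Qed.

Lemma coboundaryB z z' : tlb_coboundary A 2 z -> tlb_coboundary A 2 z' ->
  tlb_coboundary A 2 (z - z').
Proof.
move=> /shear_coboundaryP[N ->] /shear_coboundaryP[N' ->].
by apply/shear_coboundaryP; exists (N - N'); rewrite shear_coboundaryB.
Qed.

End Equivalence.

Theorem theorem4p29 (K : fieldType) (charK : [pchar K] =i pred0)
    (g : vectType K) (A : tlb g) :
  exists F : set (tlb (Rext g)) -> set (multimap g 2 * multivec K g 2),
    set_bij (deformation_classes A) (tlb_cohomology A 2) F.
Proof.
have char2 : (2%:R : K) != 0 by have := charK 2; rewrite inE /= => ->.
pose class D := [set D' | deformation A D' /\ equivalent D D'].
pose coset (z : multimap g 2 * multivec K g 2) :=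
  [set z + b | b in tlb_coboundary A 2].
have classE D : deformation A D ->
    [set eps_part D' | D' in class D] = coset (eps_part D).
  move=> dD; apply/seteqP; split=> z.
    move=> [D' [dD' /(equivalentP dD dD') eDD'] <-].
    by exists (eps_part D' - eps_part D) => //; rewrite addrC subrK.
  move=> [_ /shear_coboundaryP[N ->] <-].
  (* Pulling back along the shear of [N] shifts the t-part by its coboundary. *)
  have [phi phiE] := shear_exists N.
  have [D' dD' hom] := shear_pullback phiE dD.
  have E := (shear_homP phiE dD dD').1 hom.
  exists D'; last by rewrite -E addrC subrK.
  split=> //; apply/(equivalentP dD dD')/shear_coboundaryP.
  by exists N.
exists (fun C => [set eps_part D | D in C]); split.
- move=> C [D dD <-]; rewrite classE //; exists (eps_part D) => //.
  exact: (eps_part_cocycle char2).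
- move=> C1 C2 /set_mem [D1 dD1 <-] /set_mem [D2 dD2 <-].
  rewrite !classE // => E.
  have [b Bb e12] : coset (eps_part D2) (eps_part D1).
    by rewrite -E; exists 0; [exact: coboundary0 | rewrite addr0].
  have shift z : z - eps_part D2 = (z - eps_part D1) + b.
    by rewrite -e12 opprD addrA subrK.
  apply/seteqP; split=> D [dD eD]; split=> //.
    apply/(equivalentP dD2 dD); rewrite shift -[b]opprK.
    apply: coboundaryB; first exact/(equivalentP dD1 dD).
    by rewrite -sub0r; apply: coboundaryB => //; exact: coboundary0.
  apply/(equivalentP dD1 dD); rewrite -[_ - _](addrK b) -shift.
  by apply: coboundaryB => //; exact/(equivalentP dD2 dD).
- move=> C [z Zz <-]; have [D dD E] := cocycle_eps_part Zz.
  exists (class D); first by exists D.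
  by rewrite classE // E.
Qed.
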